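(* Let $p,q\in[0,1]$ with $p+q=1$ and $p\neq q$. Let $S_n=\sum_{k=1}^n X_k$, $S_0=0$, where $X_1,X_2,\dots$ are independent and identically distributed random variables with $\mathcal P(X_k=1)=p$ and $\mathcal P(X_k=-1)=q$, and let $E_{2n}=\{S_{2n}=0\}$ be the event that a return to the origin occurs at time $2n$. Then the probability that infinitely many of the events $E_{2n}$ occur is $0$, i.e. $$\mathcal P\Big(\limsup_{n\to\infty}E_{2n}\Big)=0 .$$
   Context: For a sequence of events, $\limsup_{n\to\infty}E_{2n}=\bigcap_{N=1}^{\infty}\bigcup_{n=N}^{\infty}E_{2n}$. *)

(* Defs.v *)
From HB Require Import structures.
From mathcomp Require Import all_boot all_order all_algebra finmap.
From mathcomp Require Import all_classical all_reals all_analysis.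

Set Implicit Arguments.
Unset Strict Implicit.
Unset Printing Implicit Defensive.

Import Order.TTheory GRing.Theory Num.Theory.
Import numFieldNormedType.Exports.

Local Open Scope classical_set_scope.
Local Open Scope ring_scope.

(* Mutual independence: the product rule over every finite subfamily. *)
Definition independent_RVs (d d' : measure_display) (T : measurableType d)
    (T' : measurableType d') (R : realType) (P : probability T R)
    (I : choiceType) (X : I -> {RV P >-> T'}) : Prop :=
  forall (J : {fset I}) (A : I -> set T'), (forall i, measurable (A i)) ->
    P (\bigcap_(i in [set` J]) (X i @^-1` A i)) =
      (\prod_(i <- J) P (X i @^-1` A i))%E.

Definition identically_distributed (d d' : measure_display)
    (T : measurableType d) (T' : measurableType d') (R : realType)
    (P : probability T R) (I : Type) (X : I -> {RV P >-> T'}) : Prop :=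
  forall (i j : I) (A : set T'), measurable A ->
    distribution P (X i) A = distribution P (X j) A.

(* Steps are indexed from 0: [X k] is the (k+1)-st step X_{k+1}, so that
   [walk X n] is S_n = X_1 + ... + X_n and [walk X 0] is 0. *)
Definition walk (T : Type) (R : realType) (X : nat -> T -> R) (n : nat)
    (w : T) : R :=
  \sum_(k < n) X k w.

Definition at_origin (T : Type) (R : realType) (X : nat -> T -> R) (n : nat) :
    set T :=
  [set w | walk X n w = 0].

(* Main.v *)
(* The event S_{2n} = 0 is covered, up to a null set, by the sign patterns of
   length 2n with n plus signs.  Each has probability (pq)^n by independence,
   and there are at most 2^{2n} of them, so P(E_{2n}) <= (4pq)^n.  Since p <> q,
   4pq = 1 - (p - q)^2 < 1, the geometric series converges, and the first
   Borel-Cantelli lemma applies. *)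
Require Import Defs.
From HB Require Import structures.
From mathcomp Require Import all_boot all_order all_algebra finmap.
From mathcomp Require Import all_classical all_reals all_analysis.
From mathcomp Require Import ring.

Import Order.TTheory GRing.Theory Num.Theory.
Import numFieldNormedType.Exports.

Local Open Scope classical_set_scope.
Local Open Scope ring_scope.

(** A zero sum forces as many plus signs as minus signs, hence [n] of each among the [2 * n]
    indices; the product then has [n] factors [p] and [n] factors [q]. *)
Lemma prod_balanced (R : realFieldType) (p q : R) (n : nat)
    (e : 'I_(2 * n) -> bool) :
  \sum_k (if e k then 1 else -1) = 0 :> R ->
  \prod_k (if e k then p else q) = (p * q) ^+ n.
Proof.
rewrite (bigID e) /= [X in X + _](eq_bigr (fun=> 1)); last by move=> k ->.
rewrite [X in _ + X](eq_bigr (fun=> -1)); last by move=> k /negbTE ->.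
rewrite !sumr_const mulNrn.
move/eqP; rewrite subr_eq0 eqr_nat => /eqP card_eq.
have := cardC e; rewrite card_ord.
have -> : #|[predC e]| = #|e| by rewrite [RHS]card_eq; apply: eq_card.
rewrite addnn -mul2n => /eqP; rewrite eqn_pmul2l// => /eqP en.
rewrite (bigID e) /= [X in X * _](eq_bigr (fun=> p)); last by move=> k ->.
rewrite [X in _ * X](eq_bigr (fun=> q)); last by move=> k /negbTE ->.
by rewrite !prodr_const -card_eq en exprMn.
Qed.

Lemma measure_bigsetU_le (R : realFieldType) (d : measure_display)
    (T : measurableType d) (mu : measure T R) (I : Type) (s : seq I)
    (Q : pred I) (F : I -> set T) :
  (forall i, measurable (F i)) ->
  (mu (\big[setU/set0]_(i <- s | Q i) F i) <= \sum_(i <- s | Q i) mu (F i))%E.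
Proof.
move=> mF; elim: s => [|i s IHs]; first by rewrite !big_nil measure0.
rewrite !big_cons; case: ifP => // _.
by apply: le_trans (measureU2 _ _ _) _ => //;
  [exact: bigsetU_measurable|exact: leeD2l].
Qed.

Lemma independent_RVs_ord (d d' : measure_display) (T : measurableType d)
    (T' : measurableType d') (R : realType) (P : probability T R)
    (X : nat -> {RV P >-> T'}) (m : nat) (A : nat -> set T') :
  independent_RVs X -> (forall i, measurable (A i)) ->
  P (\bigcap_(i < m) (X i @^-1` A i)) = (\prod_(i < m) P (X i @^-1` A i))%E.
Proof.
move=> indX mA; have := indX (seq_fset tt (iota 0 m)) A mA.
(* The enumeration of the finite set {0, ..., m-1} is known only up to permutation, which a
   commutative product does not see. *)
rewrite (perm_big (iota 0 m)); last first.
  by apply: (perm_trans (seq_fset_perm _ _)); rewrite undup_id ?iota_uniq.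
rewrite -[X in iota 0 X]subn0 -/(index_iota 0 m) big_mkord => <-.
congr (P _); apply: eq_bigcapl.
by split=> i; rewrite /mkset seq_fsetE mem_iota add0n subn0.
Qed.

Lemma measurable_at_origin (d : measure_display) (T : measurableType d)
    (R : realType) (P : probability T R) (X : nat -> {RV P >-> R}) (n : nat) :
  measurable (at_origin X n).
Proof.
have mW : measurable_fun [set: T] (walk X n) by exact: measurable_sum.
by rewrite -[at_origin X n]setTI; exact: (mW measurableT [set 0]).
Qed.

Section steps.
Variables (R : realType) (d : measure_display) (T : measurableType d).
Variables (P : probability T R) (p q : R) (X : nat -> {RV P >-> R}).
Hypothesis hpq : p + q = 1.
Hypothesis hX1 : forall k, P [set w | X k w = 1] = p%:E.
Hypothesis hXN1 : forall k, P [set w | X k w = -1] = q%:E.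

(** Coding signs by booleans makes the patterns of length [m] a finite type, over which one can take
    unions and count. *)
Let sgn (b : bool) : R := if b then 1 else -1.

Lemma prob_sign_preimage k b :
  P (X k @^-1` [set sgn b]) = (if b then p else q)%:E.
Proof. by case: b; [exact: hX1|exact: hXN1]. Qed.

Lemma measurable_sign_preimage k b : measurable (X k @^-1` [set sgn b]).
Proof. exact: measurable_funPTI. Qed.

(** The hypotheses fix only the probabilities of the values 1 and -1, so a step may take other
    values on a null set, isolated here. *)
Definition non_sign (k : nat) : set T :=
  ~` (X k @^-1` [set sgn true] `|` X k @^-1` [set sgn false]).

Lemma measurable_non_sign k : measurable (non_sign k).
Proof.
by apply: measurableC; apply: measurableU; exact: measurable_sign_preimage.
Qed.

Lemma prob_non_sign k : P (non_sign k) = 0%E.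
Proof.
have PU : P (X k @^-1` [set sgn true] `|` X k @^-1` [set sgn false]) =
    (P (X k @^-1` [set sgn true]) + P (X k @^-1` [set sgn false]))%E.
  apply: measureU; try exact: measurable_sign_preimage.
  (* The two sign events are disjoint: 1 = -1 would give 1 + 1 = 0 in an ordered field. *)
  rewrite -subset0 => w [/= -> ] /eqP.
  by rewrite -subr_eq0 opprK gt_eqF// addr_gt0.
rewrite probability_setC; last first.
  by apply: measurableU; exact: measurable_sign_preimage.
by rewrite PU !prob_sign_preimage -EFinD hpq subrr.
Qed.

Lemma prob_bigsetU_non_sign m : P (\big[setU/set0]_(k < m) non_sign k) = 0%E.
Proof.
apply/eqP; rewrite eq_le measure_ge0 andbT.
apply: le_trans (Boole_inequality _ _) _ => [k _|].
  exact: measurable_non_sign.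
by rewrite big1// => k _; exact: prob_non_sign.
Qed.

(** Reading [t] with [nth] gives a family of targets indexed by all of [nat], as independence
    requires; the default [false] is never reached for [k < m]. *)
Let cylinder m (t : m.-tuple bool) : set T :=
  \bigcap_(k < m) (X k @^-1` [set sgn (nth false t k)]).

Lemma measurable_cylinder m (t : m.-tuple bool) : measurable (cylinder m t).
Proof.
by apply: bigcap_measurableType => k _; exact: measurable_sign_preimage.
Qed.

Let balanced m (t : m.-tuple bool) :=
  \sum_(k < m) sgn (nth false t k) == 0.

Lemma at_origin_cover m :
  at_origin X m `<=` \big[setU/set0]_(k < m) non_sign k `|`
    \big[setU/set0]_(t : m.-tuple bool | balanced m t) cylinder m t.
Proof.
move=> w Xw; rewrite -bigcup_mkord -bigcup_pred.
have [[k km kw]|signs] := pselect (exists2 k, (k < m)%N & non_sign k w).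
  by left; exists k.
have {signs}sgnE k : (k < m)%N -> X k w = sgn (X k w == 1).
  move=> km; case: eqP => //= Xk1.
  apply: contrapT => XkN1; apply: signs; exists k => //.
  by case.
(* With every step a sign, [w] lies in the cylinder of its own pattern [t], whose signs add up to
   the walk at time [m], that is, to 0. *)
pose t : m.-tuple bool := [tuple X k w == 1 | k < m].
have tE k (km : (k < m)%N) : nth false t k = (X k w == 1).
  by have := tnth_mktuple (fun k => X k w == 1) (Ordinal km);
    rewrite (tnth_nth false).
right; exists t; last by move=> k km; rewrite /= tE// -sgnE.
apply/eqP; rewrite -[RHS]Xw.
by apply: eq_bigr => k _; rewrite tE// -sgnE.
Qed.

Hypothesis hindep : independent_RVs X.

(** Independence factors the probability into one [p] or [q] per step, and balance fixes how many of
    each occur. *)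
Lemma prob_balanced_cylinder n (t : (2 * n).-tuple bool) :
  balanced _ t -> P (cylinder _ t) = ((p * q) ^+ n)%:E.
Proof.
move=> /eqP bt; rewrite /cylinder.
rewrite (independent_RVs_ord _ _ _ _ _ _ _ _ (fun k => [set sgn (nth false t k)]))//.
rewrite -(prod_balanced _ _ _ _ (fun k => nth false t k) bt) -prodEFin.
by apply: eq_bigr => k _; exact: prob_sign_preimage.
Qed.

Lemma prob_at_origin_le n : 0 <= p -> 0 <= q ->
  (P (at_origin X (2 * n)) <= ((4 * (p * q)) ^+ n)%:E)%E.
Proof.
move=> p0 q0.
have mN : measurable (\big[setU/set0]_(k < 2 * n) non_sign k).
  by apply: bigsetU_measurable => k _; exact: measurable_non_sign.
have mC : measurable (\big[setU/set0]_(t : (2 * n).-tuple bool | balanced _ t)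
    cylinder _ t).
  by apply: bigsetU_measurable => t _; exact: measurable_cylinder.
apply: (@le_trans _ _ (P (\big[setU/set0]_(k < 2 * n) non_sign k `|`
    \big[setU/set0]_(t : (2 * n).-tuple bool | balanced _ t) cylinder _ t))).
  rewrite le_measure ?inE//; [exact: measurable_at_origin|exact: measurableU|].
  exact: at_origin_cover.
apply: le_trans (measureU2 _ _ _) _ => //.
rewrite [X in (X + _)%E]prob_bigsetU_non_sign add0e.
apply: le_trans (measure_bigsetU_le _ _ _ _ _ _ _ _ _) _.
  by move=> t; exact: measurable_cylinder.
rewrite (eq_bigr (fun=> ((p * q) ^+ n)%:E)); last exact: prob_balanced_cylinder.
rewrite sumEFin lee_fin sumr_const [leRHS]exprMn -[leLHS]mulr_natl ler_wpM2r//.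
  by rewrite exprn_ge0// mulr_ge0.
(* The balanced patterns are crudely counted by all patterns, of which there are 2^(2n) = 4^n. *)
rewrite -natrX ler_nat; apply: leq_trans (max_card _) _.
by rewrite card_tuple card_bool expnM.
Qed.

End steps.

Theorem proposition5p2 (R : realType) (d : measure_display)
    (T : measurableType d) (P : probability T R) (p q : R)
    (X : nat -> {RV P >-> R})
    (hp : 0 <= p <= 1) (hq : 0 <= q <= 1) (hpq : p + q = 1) (hneq : p <> q)
    (hindep : independent_RVs X) (hid : identically_distributed X)
    (hX1 : forall k, P [set w | X k w = 1] = p%:E)
    (hXN1 : forall k, P [set w | X k w = -1] = q%:E) :
  P (lim_sup_set (fun n => at_origin X (2 * n))) = 0%E.
Proof.
have /andP[p0 _] := hp; have /andP[q0 _] := hq.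
have r0 : 0 <= 4 * (p * q) by rewrite !mulr_ge0.
have r1 : 4 * (p * q) < 1.
  have : 0 < (p - q) ^+ 2 by rewrite exprn_even_gt0//= subr_eq0; exact/eqP.
  have -> : (p - q) ^+ 2 = (p + q) ^+ 2 - 4 * (p * q) by ring.
  by rewrite hpq expr1n subr_gt0.
(* First Borel-Cantelli lemma: what remains is that the probabilities have a finite sum. *)
apply: lim_sup_set_cvg0 => [n|]; first exact: measurable_at_origin.
apply: (@le_lt_trans _ _
    (\sum_(0 <= n <oo) ((4 * (p * q)) ^+ n)%:E)%E).
  by apply: lee_nneseries => // n _; exact: prob_at_origin_le.
(* The extended-real partial sums are those of a convergent real geometric series, so their limit is
   a real number and thus finite. *)
have -> : (fun n => \sum_(0 <= k < n) ((4 * (p * q)) ^+ k)%:E)%E =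
    EFin \o series (geometric 1 (4 * (p * q))).
  apply/funext => n /=; rewrite sumEFin; congr EFin.
  by apply: eq_bigr => k _; rewrite /geometric/= mul1r.
rewrite EFin_lim ?ltry//.
by apply: is_cvg_geometric_series; rewrite ger0_norm.
Qed.
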